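(* Let $p\ge q\ge r\ge 2$ be integers. Assume that there is a fixed $\kappa\ge 0$ such that, uniformly for nonzero $\lambda,\mu,\nu\in\mathbb Z$, for every integer $0\le k\le r-1$, for all $X,Y,Z\ge 2$ and every $\varepsilon>0$, we have \[ \#\left\{(x,y,z)\in\mathbb N^3:\ x\le X,\ y\le Y,\ z\le Z,\ \gcd(x,y,z)=1,\ \lambda x^p+\mu y^q=\nu z^{r+k}\right\}\ll_{\varepsilon,p}H^{\varepsilon}\max\{X,Y\}^{\kappa}, \] with $H=\max\{X,Y,Z\}$. Then \[ N(B)\ll_{\delta,p}B^{\frac1p+\frac1q-\delta} \] for all $B\ge 1$ and any \[ \delta<\frac{\displaystyle \frac1p+\frac1q-\left(\frac1r-\frac1{qr}+\frac{\kappa}{q}\right)}{p+q+1+1/r}. \]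
   Context: $\mathbb N$ denotes the positive integers. For an integer $m\ge 2$, a nonzero integer $n$ is called $m$-full if for every prime $\ell$ either $v_\ell(n)=0$ or $v_\ell(n)\ge m$, where $v_\ell$ is the $\ell$-adic valuation. Let $\mathcal S_m$ denote the set of positive $m$-full integers (so $1\in\mathcal S_m$), and define \[ N(B)=\#\left\{(a,b,c)\in(\mathcal S_p\times\mathcal S_q\times\mathcal S_r)\cap[1,B]^3:\ \gcd(a,b,c)=1,\ a+b=c\right\}. \] The notation $\ll$ with subscripts means that the implied constant depends only on the subscripted parameters (and, in the conclusion, on $\kappa$ and the implied constants in the hypothesis, which are regarded as fixed). *)

(* Defs.v *)
From mathcomp Require Import all_boot all_order all_algebra.
From mathcomp Require Import finmap.
From mathcomp Require Import all_classical all_reals all_analysis.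
Import Order.TTheory GRing.Theory Num.Theory.

Set Implicit Arguments.
Unset Strict Implicit.
Unset Printing Implicit Defensive.

Local Open Scope classical_set_scope.
Local Open Scope ring_scope.

Definition full (m n : nat) : Prop :=
  (0 < n)%N /\
  forall l : nat, prime l -> logn l n = 0%N \/ (m <= logn l n)%N.

Definition abc_triples (R : realType) (p q r : nat) (B : R) :
    set (nat * nat * nat) :=
  [set t | let: (a, b, c) := t in
    [/\ [/\ full p a, full q b & full r c],
        [/\ a%:R <= B, b%:R <= B & c%:R <= B],
        gcdn (gcdn a b) c = 1%N & (a + b)%N = c]].

Definition fermat_solutions (R : realType) (d e f : nat) (la mu nu : int)
    (X Y Z : R) : set (nat * nat * nat) :=
  [set t | let: (x, y, z) := t in
    [/\ [/\ (0 < x)%N, (0 < y)%N & (0 < z)%N],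
        [/\ x%:R <= X, y%:R <= Y & z%:R <= Z],
        gcdn (gcdn x y) z = 1%N &
        la * x%:Z ^+ d + mu * y%:Z ^+ e = nu * z%:Z ^+ f]].

(* [fset_set] sends infinite sets to the empty one; the two finiteness lemmas
   below show that this convention is never used. *)
Definition num_triples (A : set (nat * nat * nat)) : nat := #|` fset_set A|%fset.

Lemma finite_box (R : realType) (X Y Z : R) (A : set (nat * nat * nat)) :
  (forall x y z, A (x, y, z) -> [/\ x%:R <= X, y%:R <= Y & z%:R <= Z]) ->
  finite_set A.
Proof.
move=> AX.
have le_truncn (n : nat) (W : R) : n%:R <= W -> (n < (Num.truncn W).+1)%N.
  by move=> nW; rewrite ltnS truncn_ge_nat// (le_trans _ nW).
apply: (@sub_finite_set _ _ (`I_(Num.truncn X).+1 `*` `I_(Num.truncn Y).+1 `*`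
                             `I_(Num.truncn Z).+1)).
  by move=> [[x y] z] /AX[xX yY zZ]; do ![split] => /=; exact: le_truncn.
by apply: finite_setX; [apply: finite_setX|]; exact: finite_II.
Qed.

Lemma abc_triples_finite (R : realType) (p q r : nat) (B : R) :
  finite_set (abc_triples p q r B).
Proof. by apply: (@finite_box R B B B) => a b c []. Qed.

Lemma fermat_solutions_finite (R : realType) (d e f : nat) (la mu nu : int)
    (X Y Z : R) :
  finite_set (fermat_solutions d e f la mu nu X Y Z).
Proof. by apply: (@finite_box R X Y Z) => x y z []. Qed.

(* Main.v *)
Require Import Defs.
From mathcomp Require Import all_boot all_order all_algebra.
From mathcomp Require Import all_classical all_reals all_analysis.
From mathcomp Require Import finmap.
From mathcomp Require Import zify ring lra.
Import Order.TTheory GRing.Theory Num.Theory.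

Local Open Scope ring_scope.

(** Every m-full n is a product of powers z_i ^ (m + i), i < m. Isolating the
    factor i = 0 writes a = al * x ^ p and b = be * y ^ q with al (p+1)-full
    and be (q+1)-full ([full_peel]). Isolating instead the largest factor
    writes c = nu * z ^ (r + k), k < r, where nu is still r-full and
    nu <= c ^ (1 - 1/r) ([full_large_power]). So a + b = c becomes a
    generalised Fermat equation in (x, y, z) with coefficients (al, be, nu),
    and gcd (x, y, z) = 1 is inherited from gcd (a, b, c) = 1.

    Fix d slightly larger than delta and the thresholds A1 = B ^ (p (p+1) d)
    and A2 = B ^ (q (q+1) d).
    - If al >= A1, then a belongs to a set of size about
      B ^ (1/p) * A1 ^ (- 1/(p (p+1))) = B ^ (1/p - d) ([full_tail_count]);
      b takes about B ^ (1/q) values and c is determined. The case be >= A2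
      is symmetric.
    - If al < A1 and be < A2, then al and be take about B ^ (p d) and
      B ^ (q d) values, because the m-full numbers up to T number about
      T ^ (1/m) ([full_count]), and nu takes about
      (B ^ (1 - 1/r)) ^ (1/r) <= B ^ (1/r - 1/(q r)) values. For each choice
      of (al, be, nu, k) the hypothesis bounds the number of (x, y, z) by about
      B ^ (kappa / q), as x and y are at most B ^ (1/q).
    The first two cases are acceptable since d > delta, the third one as soon as
    (p + q) d + 1/r - 1/(q r) + kappa/q < 1/p + 1/q - delta, which the
    assumption on delta ensures ([exponent_choice]). If delta < 0, the trivial
    bound B ^ (1/p + 1/q + eps) on the number of pairs (a, b) suffices.

    All the counts come from Rankin's trick: the Dirichlet series of the
    m-full numbers converges at every s > 1/m, being dominated by the product
    of the series of the numbers z ^ (m + i) ([full_sum_bounded]). The losses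
    of B ^ eps are absorbed by the gap between delta and its upper bound, or by
    - delta if delta < 0. *)

(** * Counting by covering *)

(** The function [f] keeps apart the witnesses of distinct elements, so no term
    of the right-hand side is used twice. With [g] equal to 1 this bounds the
    size of [s]; with [w] a Rankin weight it bounds it by a Dirichlet series. *)
Lemma sum_le_cover (R : numDomainType) (S T : eqType) (f : T -> S)
    (g : S -> R) (w : T -> R) (s : seq S) (t : seq T) :
  uniq s -> (forall z, 0 <= w z) ->
  (forall x, x \in s -> exists z, [/\ z \in t, f z = x & g x <= w z]) ->
  \sum_(x <- s) g x <= \sum_(z <- t) w z.
Proof.
move=> + w0; elim: s t => [|x s IH] t /=.
  by move=> _ _; rewrite big_nil sumr_ge0.
move=> /andP[xs us] H.
have [z [zt fz gw]] := H x (mem_head _ _).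
rewrite big_cons (perm_big _ (perm_to_rem zt)) big_cons lerD//.
apply: IH => // y ys; have [|z' [z't fz' gw']] := H y.
  by rewrite inE ys orbT.
exists z'; split => //; move: z't; rewrite (perm_mem (perm_to_rem zt)) inE.
case/orP => // /eqP z'z; move: xs; by rewrite -fz -z'z fz' ys.
Qed.

Lemma num_triples_le (A : set (nat * nat * nat)) (s : seq (nat * nat * nat)) :
  (forall t, A t -> t \in s) -> (num_triples A <= size s)%N.
Proof.
move=> As; rewrite /num_triples; apply: uniq_leq_size (fset_uniq _) _ => t.
have fA : finite_set A.
  by apply: (sub_finite_set _ (finite_seq s)) => x /As.
by rewrite in_fset_set// => /set_mem/As.
Qed.

(** * Powerful numbers *)

Lemma fullM m a b : full m a -> full m b -> full m (a * b).
Proof.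
move=> [a0 Ha] [b0 Hb]; split=> [|l pl]; first by rewrite muln_gt0 a0.
rewrite lognM//; have := Ha l pl; have := Hb l pl; lia.
Qed.

Lemma full1 m : full m 1.
Proof. by split=> // l _; left; rewrite logn1. Qed.

Lemma fullX m e x : (m <= e)%N -> (0 < x)%N -> full m (x ^ e).
Proof.
move=> me x0; split=> [|l pl]; first by rewrite expn_gt0 x0.
rewrite lognX; case: (logn l x) => [|k]; first by left; rewrite muln0.
right; rewrite mulnS; lia.
Qed.

Lemma full_prodX (I : finType) (P : pred I) (z e : I -> nat) m :
  (forall i, P i -> (m <= e i)%N) -> (forall i, (0 < z i)%N) ->
  full m (\prod_(i | P i) z i ^ e i)%N.
Proof.
move=> me z0; apply: (big_ind (full m)); [exact: full1|exact: fullM|].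
by move=> i Pi; apply: fullX; [exact: me|exact: z0].
Qed.

(** Both sides being multiplicative, it suffices to represent the prime powers
    l ^ e with e >= m. *)
Lemma full_factor m n : (0 < m)%N -> full m n ->
  exists z : 'I_m -> nat,
    (forall i, (0 < z i)%N) /\ n = (\prod_(i < m) z i ^ (m + i))%N.
Proof.
move=> m0 [n0 Hn].
pose rep (n : nat) := exists z : 'I_m -> nat,
    (forall i, (0 < z i)%N) /\ n = (\prod_(i < m) z i ^ (m + i))%N.
rewrite -/(rep n).
have rep1 : rep 1%N.
  by exists (fun=> 1%N); split=> //; rewrite big1// => i _; rewrite exp1n.
have repM a b : rep a -> rep b -> rep (a * b)%N.
  move=> [z [z0 ->]] [z' [z'0 ->]]; exists (fun i => (z i * z' i)%N).
  split=> [i|]; first by rewrite muln_gt0 z0 z'0.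
  by rewrite -big_split/=; apply: eq_bigr => i _; rewrite expnMn.
have repX i x : (0 < x)%N -> (i < m)%N -> rep (x ^ (m + i))%N.
  move=> x0 im; exists (fun j => if j == Ordinal im then x else 1%N).
  split=> [j|]; first by case: ifP.
  rewrite (bigD1 (Ordinal im))//= eqxx big1 ?muln1// => j /negPf ->.
  by rewrite exp1n.
rewrite (prod_prime_decomp n0) prime_decompE big_map/= big_seq.
apply: (big_ind rep) => // l; rewrite mem_primes => /and3P[pl _ ln].
have l0 := prime_gt0 pl.
have le : (m <= logn l n)%N.
  by case: (Hn l pl) => // l1; move: ln; rewrite -[l]expn1 pfactor_dvdn// l1.
(* An exponent e >= m is m * (e %/ m - 1) plus the exponent m + (e %% m). *)
have -> : logn l n = (m * (logn l n %/ m).-1 + (m + logn l n %% m))%N.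
  rewrite addnA -mulnSr prednK ?divn_gt0// mulnC -divn_eq//.
rewrite expnD; apply: repM; last by apply: repX; rewrite ?ltn_mod.
rewrite mulnC expnM -[m in X in rep X]addn0; apply: repX => //.
by rewrite expn_gt0 l0.
Qed.

Lemma full_peel m n : (0 < m)%N -> full m n ->
  exists x al, [/\ (0 < x)%N, full m.+1 al & n = (al * x ^ m)%N].
Proof.
move=> m0 /(full_factor _ _ m0)[z [z0 ->]].
exists (z (Ordinal m0)), (\prod_(i < m | i != Ordinal m0) z i ^ (m + i))%N.
split=> //; last by rewrite (bigD1 (Ordinal m0))//= addn0 mulnC.
apply: full_prodX => // i; rewrite -val_eqE/=; lia.
Qed.

(** Among m factors of product n the largest is at least n ^ (1/m), so its
    cofactor nu is at most n ^ (1 - 1/m). The cofactor is a product of the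
    z_i ^ (m + i) with i <> k, hence still m-full, and so has few possible
    values, about n ^ (1/m - 1/m^2) of them for n of a given size. *)
Lemma full_large_power m n : (0 < m)%N -> full m n ->
  exists k x nu, [/\ (k < m)%N, (0 < x)%N, full m nu,
    n = (nu * x ^ (m + k))%N & (nu ^ m <= n ^ m.-1)%N].
Proof.
move=> m0 /(full_factor _ _ m0)[z [z0 nz]].
pose f (i : 'I_m) := (z i ^ (m + i))%N.
have [k _ kmax] := arg_maxnP f (isT : xpredT (Ordinal m0)).
pose nu := (\prod_(i < m | i != k) f i)%N.
have nE : n = (nu * f k)%N by rewrite nz (bigD1 k)//= mulnC.
exists k, (z k), nu; split=> //.
  by apply: full_prodX => // i _; rewrite leq_addr.
have nu_le : (nu <= f k ^ m.-1)%N.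
  apply: (@leq_trans (\prod_(i < m | i != k) f k)%N).
    by apply: leq_prod => i _; exact: kmax.
  by rewrite prod_nat_const cardC1 card_ord.
rewrite nE expnMn -[X in (nu ^ X)%N](prednK m0) expnSr.
by rewrite leq_mul2l nu_le orbT.
Qed.

(** * Dirichlet series bounds *)

(** Splitting the sum S over n <= 2 N + 1 into odd and even terms, and comparing
    each 2 k + 1 with 2 k, gives S (2 N + 1) <= 1 + 2 ^ (1 - t) S N. Since
    S N <= S (2 N + 1) and 2 ^ (1 - t) < 1, this bounds S N. *)
Lemma zeta_bounded (R : realType) (t : R) : 1 < t ->
  exists K : R, forall N : nat, \sum_(1 <= n < N.+1) n%:R `^ (- t) <= K.
Proof.
move=> t1; pose S N : R := \sum_(1 <= n < N.+1) n%:R `^ (- t).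
pose h : R := 2 `^ (- t).
have h2 : 2 * h < 1.
  have -> : 2 * h = 2 `^ (1 - t).
    by rewrite powRD ?pnatr_eq0 ?implybT// powRr1.
  rewrite /powR pnatr_eq0/= -[ltRHS]expR0 ltr_expR nmulr_rlt0 ?subr_lt0//.
  by rewrite ln_gt0// ltr1n.
have S_double N : S (2 * N).+1 <= 1 + 2 * h * S N.
  elim: N => [|N IH]; first by rewrite /S muln0 big_nat1 powR1 big_geq// mulr0 addr0.
  rewrite {1}/S mulnS !add2n 2?big_nat_recr//= -/(S (2 * N).+1).
  rewrite {2}/S big_nat_recr//= -/(S N).
  have e1 : ((2 * N).+2)%:R `^ (- t) = h * N.+1%:R `^ (- t) :> R.
    by rewrite -powRM// -natrM; congr (_%:R `^ _); lia.
  have e2 : ((2 * N).+3)%:R `^ (- t) <= h * N.+1%:R `^ (- t) :> R.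
    rewrite -e1 !powRN lef_pV2 ?posrE ?powR_gt0//.
    by apply: ge0_ler_powR; rewrite ?nnegrE ?ler_nat//; lra.
  rewrite e1; lra.
exists (1 - 2 * h)^-1 => N; rewrite -/(S N) -div1r ler_pdivlMr; last by lra.
have : S N <= S (2 * N).+1.
  rewrite /S [leRHS](big_cat_nat _ (n := N.+1))//=; last by lia.
  by rewrite lerDl sumr_ge0// => i _; rewrite powR_ge0.
have := S_double N; lra.
Qed.

Definition full_upto (R : realType) (m : nat) (T : R) : seq nat :=
  [seq n <- index_iota 1 (Num.truncn T).+1 | `[< full m n >]].

Lemma full_uptoP (R : realType) (m n : nat) (T : R) : 0 <= T ->
  reflect (full m n /\ n%:R <= T) (n \in full_upto R m T).
Proof.
move=> T0; rewrite mem_filter mem_index_iota ltnS truncn_ge_nat//.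
apply: (iffP and3P) => [[/asboolP fn _ nT]|[fn nT]]; first by [].
by split=> //; [apply/asboolP|case: fn].
Qed.

Lemma full_upto_uniq (R : realType) m (T : R) : uniq (full_upto R m T).
Proof. by rewrite filter_uniq// iota_uniq. Qed.

Lemma powR_natprod (R : realType) (I : Type) (r : seq I) (P : pred I)
    (F : I -> nat) (s : R) :
  ((\prod_(i <- r | P i) F i)%N)%:R `^ s = \prod_(i <- r | P i) (F i)%:R `^ s.
Proof.
elim/big_rec2: _ => [|i x y _ <-]; first by rewrite powR1.
by rewrite natrM powRM.
Qed.

Lemma powR_natX (R : realType) (a b : nat) (s : R) :
  ((a ^ b)%N)%:R `^ s = a%:R `^ (b%:R * s).
Proof. by rewrite natrX -powR_mulrn// -powRrM. Qed.

(** The sum is at most the product over i < m of the sums of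
    z ^ (- (m + i) s), each of which converges because m s > 1. *)
Lemma full_sum_bounded (R : realType) (m : nat) (s : R) : (0 < m)%N ->
  m%:R^-1 < s ->
  exists K : R, forall T : R, \sum_(n <- full_upto R m T) n%:R `^ (- s) <= K.
Proof.
move=> m0 ms.
have s0 : 0 < s by apply: le_lt_trans ms; rewrite invr_ge0.
have zb (i : 'I_m) : exists K : R, forall N : nat,
    \sum_(1 <= n < N.+1) n%:R `^ (- ((m + i)%:R * s)) <= K.
  apply: zeta_bounded; rewrite -[ltLHS](@mulfV _ m%:R); last by rewrite pnatr_eq0 -lt0n.
  rewrite (@lt_le_trans _ _ (m%:R * s))// ?ltr_pM2l ?ltr0n//.
  by rewrite ler_wpM2r ?ler_nat ?leq_addr// ltW.
have {zb}[K HK] := choice zb.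
exists (\prod_(i < m) K i) => T; set N := Num.truncn T.
pose f (z : {ffun 'I_m -> 'I_N}) := (\prod_(i < m) (z i).+1 ^ (m + i))%N.
pose w (z : {ffun 'I_m -> 'I_N}) : R :=
  \prod_(i < m) (z i).+1%:R `^ (- ((m + i)%:R * s)).
apply: (@le_trans _ _ (\sum_z w z)).
  apply: (sum_le_cover R nat _ f); first exact: full_upto_uniq.
    by move=> z; apply: prodr_ge0 => i _; rewrite powR_ge0.
  move=> n; rewrite mem_filter mem_index_iota => /and3P[/asboolP fn n0 nN].
  have [z [z0 nz]] := full_factor _ _ m0 fn.
  have zN i : ((z i).-1 < N)%N.
    rewrite -ltnS prednK//; apply: leq_ltn_trans nN; rewrite nz (bigD1 i)//=.
    apply: (@leq_trans (z i ^ (m + i))).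
      by rewrite -[X in (X <= _)%N]expn1 leq_pexp2l// ltn_addr.
    rewrite leq_pmulr// prodn_gt0// => j; by rewrite expn_gt0 z0.
  have fz : f [ffun i => Ordinal (zN i)] = n.
    by rewrite /f nz; apply: eq_bigr => i _; rewrite ffunE/= prednK.
  exists [ffun i => Ordinal (zN i)]; split => //; first by rewrite mem_index_enum.
  rewrite -fz /f /w powR_natprod; rewrite le_eqVlt; apply/orP; left; apply/eqP/eq_bigr => i _.
  by rewrite powR_natX mulrN.
rewrite /w -(bigA_distr_bigA (fun (i : 'I_m) (j : 'I_N) => j.+1%:R `^ (- ((m + i)%:R * s)))).
apply: ler_prod => i _; rewrite sumr_ge0/=; last by move=> j _; rewrite powR_ge0.
by have := HK i N; rewrite big_add1/= big_mkord.
Qed.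

(** Rankin's trick: each n <= T contributes (T / n) ^ s >= 1. *)
Lemma full_count (R : realType) (m : nat) (s : R) : (0 < m)%N ->
  m%:R^-1 < s ->
  exists K : R, forall T : R, 0 < T -> (size (full_upto R m T))%:R <= K * T `^ s.
Proof.
move=> m0 ms; have [K HK] := full_sum_bounded R m s m0 ms.
have s0 : 0 < s by apply: le_lt_trans ms; rewrite invr_ge0.
exists K => T T0; rewrite -ler_pdivrMr ?powR_gt0//; apply: le_trans (HK T).
rewrite -sum1_size natr_sum mulr_suml big_seq [leRHS]big_seq; apply: ler_sum => n.
move=> /(full_uptoP _ _ _ _ (ltW T0))[[n0 _] nT].
rewrite div1r powRN lef_pV2 ?posrE ?powR_gt0 ?ltr0n//.
by apply: ge0_ler_powR; rewrite ?nnegrE// ltW.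
Qed.

(** The m-full numbers whose [full_peel] decomposition can be taken with a
    cofactor al >= A; by [full_tail_count] they are rare. *)
Definition full_tail (R : realType) (m : nat) (A T : R) : seq nat :=
  [seq n <- full_upto R m T | `[< exists x al : nat,
     [/\ (0 < x)%N, full m.+1 al, n = (al * x ^ m)%N & A <= al%:R] >]].

(** The exponent w = 1/m - 1/(m+1) of the saving A ^ (- w) is the largest one for
    which, up to eps, the series over al of al ^ (w - 1/m) still converges,
    al being (m+1)-full. *)
Lemma full_tail_count (R : realType) (m : nat) (eps : R) : (0 < m)%N ->
  0 < eps ->
  exists K : R, forall A T : R, 0 < A -> 0 < T ->
    (size (full_tail R m A T))%:R
      <= K * T `^ (m%:R^-1 + eps) * A `^ (- (m%:R * m.+1%:R)^-1).
Proof.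
move=> m0 e0; have mR : 0 < m%:R :> R by rewrite ltr0n.
have mR1 : 0 < m.+1%:R :> R by rewrite ltr0n.
pose s : R := m%:R^-1 + eps; pose w : R := (m%:R * m.+1%:R)^-1.
have sw : s - w = m.+1%:R^-1 + eps.
  rewrite /s /w -natr1; field; rewrite !gt_eqF; lra.
have s0 : 0 < s by rewrite addr_gt0// invr_gt0.
have w0 : 0 < w by rewrite invr_gt0 mulr_gt0.
have [|K1 HK1] := full_sum_bounded R m.+1 (s - w) (ltn0Sn m); first by rewrite sw ltrDl.
have [|K2 HK2] := zeta_bounded R (m%:R * s).
  by rewrite /s mulrDr mulfV ?gt_eqF// ltrDl mulr_gt0.
exists (K1 * K2) => A T A0 T0.
have K10 : 0 <= K1.
  by apply: le_trans (HK1 T); apply: sumr_ge0 => i _; rewrite powR_ge0.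
set N := Num.truncn T.
pose g (z : nat * nat) : R := (T `^ s * A `^ (- w)) *
   (z.1%:R `^ (- (s - w)) * z.2%:R `^ (- (m%:R * s))).
pose t := [seq (al, x) | al <- full_upto R m.+1 T, x <- index_iota 1 N.+1].
apply: (@le_trans _ _ (\sum_(z <- t) g z)).
  rewrite -sum1_size natr_sum.
  apply: (sum_le_cover R nat _ (fun z => (z.1 * z.2 ^ m)%N)).
  - by rewrite filter_uniq// full_upto_uniq.
  - by move=> z; rewrite !mulr_ge0 ?powR_ge0.
  move=> n; rewrite mem_filter => /andP[/asboolP[x [al [x0 fal nE Aal]]]].
  move=> /(full_uptoP _ _ _ _ (ltW T0))[[n0 _] nT].
  have al0 : (0 < al)%N by case: fal.
  exists (al, x); split=> //.
    apply: allpairs_f.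
      apply/full_uptoP; [exact: ltW|split=> //]; apply: le_trans nT.
      by rewrite nE ler_nat leq_pmulr// expn_gt0 x0.
    rewrite mem_index_iota x0/= ltnS truncn_ge_nat; last exact: ltW.
    apply: le_trans nT; rewrite nE ler_nat.
    apply: (@leq_trans (x ^ m)); last by rewrite leq_pmull.
    by rewrite -[X in (X <= _)%N]expn1 leq_pexp2l.
  (* The weight is (T / n)^s * (al / A)^w, and both factors are >= 1. *)
  have -> : g (al, x) = (T / n%:R) `^ s * (al%:R / A) `^ w.
    rewrite /g/= !powRM ?invr_ge0 ?ltW ?ltr0n//.
    rewrite -(@powR_inv1 R n%:R)// -(@powR_inv1 R A) ?ltW// -!powRrM !mulN1r nE.
    rewrite natrM powRM// powR_natX opprB addrC (@powRD R al%:R).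
      by rewrite mulrN; ring.
    by rewrite pnatr_eq0 -lt0n al0 implybT.
  have ge1 (x1 y1 u : R) : 0 < x1 -> x1 <= y1 -> 0 < u -> 1 <= (y1 / x1) `^ u.
    move=> x10 xy u0; rewrite -(@powRr0 R (y1 / x1)) ler_powR//; last exact: ltW.
    by rewrite ler_pdivlMr// mul1r.
  by rewrite -[leLHS]mulr1 ler_pM// ge1// ltr0n.
rewrite /t big_allpairs /g/=.
under eq_bigr do rewrite -mulr_sumr -mulr_sumr.
rewrite -mulr_sumr -mulr_suml -[leRHS]mulrA [leRHS]mulrC ler_wpM2l//.
  by rewrite mulr_ge0// powR_ge0.
by rewrite ler_pM// sumr_ge0// => i _; rewrite powR_ge0.
Qed.

(** * Covering the solutions *)

Lemma natX_le_root (R : realType) (n m : nat) (T : R) : (0 < m)%N ->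
  (n ^ m)%:R <= T -> n%:R <= T `^ m%:R^-1.
Proof.
move=> m0 nT; have T0 : 0 <= T by apply: le_trans nT.
have -> : n%:R = (n ^ m)%:R `^ m%:R^-1 :> R.
  by rewrite powR_natX mulfV ?powRr1// pnatr_eq0 -lt0n.
by apply: ge0_ler_powR; rewrite ?nnegrE ?invr_ge0.
Qed.

Lemma powR_ge1 (R : realType) (B x : R) : 1 <= B -> 0 <= x -> 1 <= B `^ x.
Proof. by move=> B1 x0; rewrite -(@powRr0 R B) ler_powR. Qed.

Lemma cofactor_le (R : realType) (r nu c : nat) (B : R) : (0 < r)%N ->
  1 <= B -> c%:R <= B -> (nu ^ r <= c ^ r.-1)%N ->
  nu%:R <= B `^ (1 - r%:R^-1).
Proof.
move=> r0 B1 cB nuc.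
have B0 : 0 <= B by apply: le_trans B1.
have -> : B `^ (1 - r%:R^-1) = (B ^+ r.-1) `^ r%:R^-1.
  rewrite -powR_mulrn// -powRrM; congr (_ `^ _).
  by rewrite -subn1 natrB// mulrBl mul1r mulfV// pnatr_eq0 -lt0n.
apply: natX_le_root => //; apply: (@le_trans _ _ ((c ^ r.-1)%:R)).
  by rewrite ler_nat.
by rewrite natrX lerXn2r// nnegrE.
Qed.

Lemma fermat_of_abc (R : realType) (d e f x y z al be nu : nat) (X Y Z : R) :
  (0 < d)%N -> (0 < e)%N -> (0 < f)%N ->
  (0 < x)%N -> (0 < y)%N -> (0 < z)%N ->
  x%:R <= X -> y%:R <= Y -> z%:R <= Z ->
  gcdn (gcdn (al * x ^ d) (be * y ^ e)) (nu * z ^ f) = 1%N ->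
  (al * x ^ d + be * y ^ e)%N = (nu * z ^ f)%N ->
  fermat_solutions d e f al%:Z be%:Z nu%:Z X Y Z (x, y, z).
Proof.
move=> d0 e0 f0 x0 y0 z0 xX yY zZ g1 E; split => //.
  apply/eqP; rewrite -dvdn1 -g1 !dvdn_gcd.
  have dvd_mul g u w n : (0 < n)%N -> (g %| w)%N -> (g %| u * w ^ n)%N.
    by move=> n0 gw; apply/dvdn_mull/(dvdn_trans gw)/dvdn_exp.
  by rewrite !dvd_mul// ?dvdn_gcdr// (dvdn_trans (dvdn_gcdl _ _))
    ?dvdn_gcdl ?dvdn_gcdr.
by rewrite -!rmorphXn -!rmorphM -rmorphD; exact: (congr1 Posz E).
Qed.

(** The three terms count the triples with al >= A1, those with be >= A2 and
    those with both cofactors below their thresholds. The box for (x, y, z)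
    is enlarged by a factor 2 so that its sides are at least 2. *)
Lemma abc_triples_le (R : realType) (p q r : nat) (A1 A2 B : R) :
  (0 < r)%N -> (r <= q)%N -> (q <= p)%N -> 1 <= B -> 0 <= A1 -> 0 <= A2 ->
  (num_triples (abc_triples p q r B) <=
    size (full_tail R p A1 B) * size (full_upto R q B)
    + size (full_upto R p B) * size (full_tail R q A2 B)
    + \sum_(al <- full_upto R p.+1 A1) \sum_(be <- full_upto R q.+1 A2)
      \sum_(nu <- full_upto R r (B `^ (1 - r%:R^-1))) \sum_(0 <= k < r)
        num_triples (fermat_solutions p q (r + k) al%:Z be%:Z nu%:Z
          (2 * B `^ q%:R^-1) (2 * B `^ q%:R^-1) (2 * B)))%N.
Proof.
move=> r0 rq qp B1 A10 A20.
have q0 : (0 < q)%N by exact: leq_trans rq.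
have p0 : (0 < p)%N by exact: leq_trans qp.
have B0 : 0 <= B by apply: le_trans B1.
set X := 2 * B `^ q%:R^-1; set Z := 2 * B.
pose abc (a b : nat) := (a, b, (a + b)%N).
pose s1 := [seq abc a b | a <- full_tail R p A1 B, b <- full_upto R q B].
pose s2 := [seq abc a b | a <- full_upto R p B, b <- full_tail R q A2 B].
pose idx := [seq (t, k) | t <- [seq (t, nu) | t <-
   [seq (al, be) | al <- full_upto R p.+1 A1, be <- full_upto R q.+1 A2],
   nu <- full_upto R r (B `^ (1 - r%:R^-1))], k <- index_iota 0 r].
pose sol (i : nat * nat * nat * nat) : seq (nat * nat * nat) :=
  let: (al, be, nu, k) := i in
  fset_set (fermat_solutions p q (r + k) al%:Z be%:Z nu%:Z X X Z).
pose h (i : nat * nat * nat * nat) (t : nat * nat * nat) :=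
  let: (al, be, nu, k) := i in let: (x, y, z) := t in
  ((al * x ^ p)%N, (be * y ^ q)%N, (nu * z ^ (r + k))%N).
pose s3 := [seq h i t | i <- idx, t <- sol i].
apply: (@leq_trans (size (s1 ++ s2 ++ s3))); last first.
  rewrite !size_cat !size_allpairs addnA leq_add2l.
  by rewrite size_allpairs_dep sumnE big_map /idx !big_allpairs.
apply: num_triples_le => -[[a b] c] [[fa fb fc] [aB bB cB] g1 E].
have [x [al [x0 fal aE]]] := full_peel _ _ p0 fa.
have [y [be [y0 fbe bE]]] := full_peel _ _ q0 fb.
have [k [z [nu [kr z0 fnu cE nuc]]]] := full_large_power _ _ r0 fc.
have [al0 be0 nu0] : [/\ (0 < al)%N, (0 < be)%N & (0 < nu)%N].
  by case: fal; case: fbe; case: fnu.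
have ma : a \in full_upto R p B by apply/full_uptoP.
have mb : b \in full_upto R q B by apply/full_uptoP.
rewrite !mem_cat; have [A1al|alA1] := leP A1 al%:R.
  apply/orP; left; rewrite -E; apply: allpairs_f => //.
  by rewrite mem_filter ma andbT; apply/asboolP; exists x, al.
apply/orP; right; have [A2be|beA2] := leP A2 be%:R.
  apply/orP; left; rewrite -E; apply: allpairs_f => //.
  by rewrite mem_filter mb andbT; apply/asboolP; exists y, be.
apply/orP; right.
have -> : (a, b, c) = h (al, be, nu, k) (x, y, z) by rewrite /h -aE -bE -cE.
apply: allpairs_f_dep.
  apply: allpairs_f; last by rewrite mem_index_iota.
  apply: allpairs_f; last first.
    apply/full_uptoP; first by rewrite powR_ge0.
    by split=> //; exact: cofactor_le nuc.
  by apply: allpairs_f; apply/full_uptoP => //; split=> //; exact: ltW.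
rewrite /sol in_fset_set; last exact: fermat_solutions_finite.
have le_root (n m u : nat) : (0 < m)%N -> (q <= m)%N -> (0 < u)%N ->
    (u * n ^ m)%:R <= B -> n%:R <= X.
  move=> m0 qm u0 uB; apply: (@le_trans _ _ (B `^ m%:R^-1)).
    by apply: natX_le_root => //; apply: le_trans uB; rewrite ler_nat leq_pmull.
  apply: (@le_trans _ _ (B `^ q%:R^-1)).
    by rewrite ler_powR// lef_pV2 ?posrE ?ltr0n// ler_nat.
  by rewrite /X ler_peMl ?powR_ge0// ler1n.
apply/mem_set/fermat_of_abc => //; rewrite -?aE -?bE -?cE //.
- by rewrite addn_gt0 r0.
- by apply: (le_root x p al) => //; rewrite -aE.
- by apply: (le_root y q be) => //; rewrite -bE.
- apply: (@le_trans _ _ B); last by rewrite /Z ler_peMl ?ler1n.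
  apply: le_trans cB; rewrite cE ler_nat; apply: (@leq_trans (z ^ (r + k))).
    by rewrite -[X in (X <= _)%N]expn1 leq_pexp2l// addn_gt0 r0.
  by rewrite leq_pmull.
Qed.

(** * Choice of the exponents *)

(** With G the gap between delta and its upper bound, d takes half of G and
    e is so small that all the multiples of e together cost at most G / 2.
    The bound 1/r^2 >= 1/(q r), from r <= q, puts the exponent
    1/r - 1/r^2 of the number of values of nu below the 1/r - 1/(q r) which
    occurs in the bound on delta. *)
Lemma exponent_choice (R : realFieldType) (p q r kappa delta : R) :
  0 < p -> 1 <= r -> r <= q -> 0 <= delta ->
  delta < (p^-1 + q^-1 - (r^-1 - (q * r)^-1 + kappa / q)) / (p + q + 1 + r^-1) ->
  exists d e : R, [/\ 0 < e, 0 <= d, 2 * e <= d - delta &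
    p * (p + 1) * d * ((p + 1)^-1 + e) + q * (q + 1) * d * ((q + 1)^-1 + e)
      + (1 - r^-1) * (r^-1 + e) + (e + kappa / q) <= p^-1 + q^-1 - delta].
Proof.
move=> p0 r1 rq d0.
have r0 : 0 < r by lra.
have q0 : 0 < q by lra.
have ri0 : 0 < r^-1 by rewrite invr_gt0.
have rr : (q * r)^-1 <= r^-1 * r^-1.
  by rewrite -invfM lef_pV2 ?posrE ?mulr_gt0// ler_wpM2r// ltW.
set num := _ - (_ - _ + _); set L := p + q + 1 + r^-1 => lt_delta.
have L1 : 1 < L by rewrite /L; lra.
pose G := num / L - delta.
have G0 : 0 < G by rewrite subr_gt0.
pose d := delta + G / 2.
have dL : d * L + G / 2 <= num.
  have -> : num = (delta + G) * L by rewrite /G addrC subrK divfK//; lra.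
  have : G <= G * L by rewrite ler_peMr//; lra.
  rewrite /d; lra.
pose W := p * (p + 1) * d + q * (q + 1) * d + 2.
have dd : 0 <= d by rewrite /d; lra.
have pd0 : 0 <= p * (p + 1) * d by rewrite !mulr_ge0//; lra.
have qd0 : 0 <= q * (q + 1) * d by rewrite !mulr_ge0//; lra.
have W2 : 2 <= W by rewrite /W; lra.
pose e := G / 2 / W.
have e0 : 0 < e by rewrite !divr_gt0//; lra.
have eW : e * W = G / 2 by rewrite /e divfK//; lra.
exists d, e; split=> //.
  have : e * 2 <= e * W by rewrite ler_pM2l.
  rewrite eW /d; lra.
have pE : p * (p + 1) * d * (p + 1)^-1 = p * d by field; lra.
have qE : q * (q + 1) * d * (q + 1)^-1 = q * d by field; lra.
rewrite (mulrDr (p * (p + 1) * d)) (mulrDr (q * (q + 1) * d)) pE qE.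
have re : (1 - r^-1) * (r^-1 + e) <= r^-1 - (q * r)^-1 + e.
  have : 0 <= r^-1 * e by rewrite mulr_ge0// ltW.
  by rewrite mulrBl mul1r mulrDr; lra.
have dr : 0 <= d * r^-1 by rewrite mulr_ge0// ltW.
have dG : delta <= d by rewrite /d; lra.
have {}dL : d * p + d * q + d + d * r^-1 + G / 2 <= num.
  by move: dL; rewrite /L !mulrDr mulr1.
have {}eW : e * (p * (p + 1) * d) + e * (q * (q + 1) * d) + e * 2 = G / 2.
  by rewrite -eW /W !(mulrDr e).
move: dL eW re; rewrite /num.
move: (p * (p + 1) * d) (q * (q + 1) * d) ((1 - r^-1) * _) (kappa / q) (_ / 2).
move: ((q * r)^-1) => ? ? ? ? ? ?; lra.
Qed.

(** * The counting estimate *)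

Lemma sum_natr_le (R : realType) (I : eqType) (s : seq I) (F : I -> nat)
    (M : R) :
  (forall x, x \in s -> (F x)%:R <= M) ->
  (\sum_(x <- s) F x)%N%:R <= (size s)%:R * M.
Proof.
move=> FM; rewrite natr_sum -sum1_size natr_sum mulr_suml.
rewrite big_seq [leRHS]big_seq; apply: ler_sum => x xs.
by rewrite mul1r FM.
Qed.

Lemma mulr_powR_le (R : realType) (K B x y : R) : 1 <= B -> x <= y ->
  K * B `^ x <= `|K| * B `^ y.
Proof.
move=> B1 xy; apply: (@le_trans _ _ (`|K| * B `^ x)).
  by rewrite ler_wpM2r ?powR_ge0// ler_norm.
by rewrite ler_wpM2l// ler_powR.
Qed.

Lemma fermat_bound_box (R : realType) (q : nat) (kappa c e B : R) :
  (0 < q)%N -> 1 <= B ->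
  let X := 2 * B `^ q%:R^-1 in
  c * Num.max (Num.max X X) (2 * B) `^ e * Num.max X X `^ kappa
    = c * 2 `^ e * 2 `^ kappa * B `^ (e + kappa / q%:R).
Proof.
move=> q0 B1 X; have B0 : 0 < B by apply: lt_le_trans B1.
have XZ : X <= 2 * B.
  by rewrite /X ler_pM2l// ler1_powR// invf_le1 ?ltr0n// ler1n.
rewrite maxxx (max_r XZ) /X !powRM ?powR_ge0 ?ltW//.
rewrite -powRrM (@powRD _ B) ?(lt0r_neq0 B0) ?implybT// [_ * kappa]mulrC; ring.
Qed.

(** With both thresholds equal to 0 every triple is in the first two classes,
    which leaves the trivial bound by the number of pairs (a, b). *)
Lemma abc_count_neg (R : realType) (p q r : nat) (delta : R) :
  (0 < r)%N -> (r <= q)%N -> (q <= p)%N -> delta < 0 ->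
  exists K : R, forall B : R, 1 <= B ->
    (num_triples (abc_triples p q r B))%:R
      <= K * B `^ (p%:R^-1 + q%:R^-1 - delta).
Proof.
move=> r0 rq qp d0.
have q0 : (0 < q)%N by exact: leq_trans rq.
have p0 : (0 < p)%N by exact: leq_trans qp.
have [|K1 HK1] := full_count R p (p%:R^-1 - delta / 2) p0; first by lra.
have [|K2 HK2] := full_count R q (q%:R^-1 - delta / 2) q0; first by lra.
exists (2 * (K1 * K2)) => B B1; have B0 : 0 < B by apply: lt_le_trans B1.
have full_upto0 m : full_upto R m 0 = [::] by rewrite /full_upto truncn0.
have := abc_triples_le R p q r 0 0 B r0 rq qp B1 (lexx _) (lexx _).
rewrite full_upto0 big_nil addn0 => /leq_trans le_count.
have {le_count} : (num_triples (abc_triples p q r B) <=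
    2 * (size (full_upto R p B) * size (full_upto R q B)))%N.
  apply: le_count; rewrite mul2n -addnn.
  by rewrite leq_add ?leq_mul// size_filter count_size.
rewrite -(ler_nat R) !natrM => /le_trans; apply.
have -> : p%:R^-1 + q%:R^-1 - delta
    = (p%:R^-1 - delta / 2) + (q%:R^-1 - delta / 2) :> R by lra.
rewrite powRD ?(lt0r_neq0 B0) ?implybT// -mulrA ler_pM2l// mulrACA.
by rewrite ler_pM ?ler0n ?HK1 ?HK2.
Qed.

Lemma abc_count_fixed (R : realType) (p q r : nat) (kappa : R) (C : R -> R)
    (delta : R) :
  (2 <= r)%N -> (r <= q)%N -> (q <= p)%N ->
  (forall eps : R, 0 < eps ->
   forall lambda mu nu : int, lambda != 0 -> mu != 0 -> nu != 0 ->
   forall k : nat, (k <= r - 1)%N ->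
   forall X Y Z : R, 2 <= X -> 2 <= Y -> 2 <= Z ->
     (num_triples (fermat_solutions p q (r + k)%N lambda mu nu X Y Z))%:R
       <= C eps * Num.max (Num.max X Y) Z `^ eps * Num.max X Y `^ kappa) ->
  delta < (p%:R^-1 + q%:R^-1
             - (r%:R^-1 - (q%:R * r%:R)^-1 + kappa / q%:R))
          / (p%:R + q%:R + 1 + r%:R^-1) ->
  exists K : R, forall B : R, 1 <= B ->
    (num_triples (abc_triples p q r B))%:R
      <= K * B `^ (p%:R^-1 + q%:R^-1 - delta).
Proof.
move=> r2 rq qp fermat; have r0 : (0 < r)%N by exact: ltnW.
have q0 : (0 < q)%N by exact: leq_trans rq.
have p0 : (0 < p)%N by exact: leq_trans qp.
have [delta0 _|delta0] := ltP delta 0; first exact: abc_count_neg.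
move=> /(exponent_choice R); rewrite ltr0n ler1n ler_nat !natr1.
case=> // d [e [e0 d0 ed Ele]].
set E := _ - delta in Ele *.
have [K1 HK1] := full_tail_count R p e p0 e0.
have [K2 HK2] := full_tail_count R q e q0 e0.
have [|K3 HK3] := full_count R p (p%:R^-1 + e) p0; first by rewrite ltrDl.
have [|K4 HK4] := full_count R q (q%:R^-1 + e) q0; first by rewrite ltrDl.
have [|K5 HK5] := full_count R p.+1 (p.+1%:R^-1 + e) (ltn0Sn p).
  by rewrite ltrDl.
have [|K6 HK6] := full_count R q.+1 (q.+1%:R^-1 + e) (ltn0Sn q).
  by rewrite ltrDl.
have [|K7 HK7] := full_count R r (r%:R^-1 + e) r0; first by rewrite ltrDl.
(* The hypothesis does not say that C is nonnegative. *)
pose M := `|C e| * 2 `^ e * 2 `^ kappa.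
have M0 : 0 <= M by rewrite !mulr_ge0 ?powR_ge0.
exists (`|K1 * K4| + `|K3 * K2| + `|K5 * K6 * K7 * r%:R * M|) => B B1.
have B0 : 0 < B by apply: lt_le_trans B1.
have BD x y : B `^ (x + y) = B `^ x * B `^ y.
  by rewrite powRD// (lt0r_neq0 B0) implybT.
pose a0 : R := p%:R * p.+1%:R * d; pose b0 : R := q%:R * q.+1%:R * d.
have a0w : (B `^ a0) `^ (- (p%:R * p.+1%:R)^-1) = B `^ (- d).
  rewrite -powRrM; congr (_ `^ _); rewrite /a0 mulrN mulrAC mulfV ?mul1r//.
  by rewrite -natrM pnatr_eq0 muln_eq0 negb_or -lt0n p0.
have b0w : (B `^ b0) `^ (- (q%:R * q.+1%:R)^-1) = B `^ (- d).
  rewrite -powRrM; congr (_ `^ _); rewrite /b0 mulrN mulrAC mulfV ?mul1r//.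
  by rewrite -natrM pnatr_eq0 muln_eq0 negb_or -lt0n q0.
have := abc_triples_le R p q r (B `^ a0) (B `^ b0) B r0 rq qp B1
  (powR_ge0 _ _) (powR_ge0 _ _).
rewrite -(ler_nat R) => /le_trans; apply.
rewrite 2!natrD !natrM 2!(mulrDl _ _ (B `^ E)); apply: lerD; first apply: lerD.
- apply: (@le_trans _ _ (K1 * K4 * B `^ (p%:R^-1 + e - d + (q%:R^-1 + e)))).
    have -> : K1 * K4 * B `^ (p%:R^-1 + e - d + (q%:R^-1 + e))
        = K1 * B `^ (p%:R^-1 + e) * (B `^ a0) `^ (- (p%:R * p.+1%:R)^-1)
          * (K4 * B `^ (q%:R^-1 + e)).
      by rewrite a0w (BD (_ - _)) (BD _ (- d)); ring.
    by apply: ler_pM; rewrite ?ler0n ?HK1 ?HK4 ?powR_gt0.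
  by apply: mulr_powR_le => //; rewrite /E; lra.
- apply: (@le_trans _ _ (K3 * K2 * B `^ (p%:R^-1 + e + (q%:R^-1 + e - d)))).
    have -> : K3 * K2 * B `^ (p%:R^-1 + e + (q%:R^-1 + e - d))
        = K3 * B `^ (p%:R^-1 + e)
          * (K2 * B `^ (q%:R^-1 + e) * (B `^ b0) `^ (- (q%:R * q.+1%:R)^-1)).
      by rewrite b0w (BD (_ + _)) (BD _ (- d)); ring.
    by apply: ler_pM; rewrite ?ler0n ?HK3 ?HK2 ?powR_gt0.
  by apply: mulr_powR_le => //; rewrite /E; lra.
pose F : R := B `^ (e + kappa / q%:R).
pose S5 := full_upto R p.+1 (B `^ a0); pose S6 := full_upto R q.+1 (B `^ b0).
pose S7 := full_upto R r (B `^ (1 - r%:R^-1)).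
apply: (@le_trans _ _ ((size S5)%:R * ((size S6)%:R * ((size S7)%:R *
    (r%:R * (M * F)))))).
  have neq0 (m n : nat) (T : R) : 0 <= T -> n \in full_upto R m T -> n%:Z != 0.
    by move=> T0 /(full_uptoP _ _ _ _ T0)[[n0 _] _]; rewrite -lt0n.
  apply: sum_natr_le => al /(neq0 _ _ _ (powR_ge0 _ _)) al0.
  apply: sum_natr_le => be /(neq0 _ _ _ (powR_ge0 _ _)) be0.
  apply: sum_natr_le => nu /(neq0 _ _ _ (powR_ge0 _ _)) nu0.
  rewrite -[in leRHS](subn0 r) -(size_iota 0 (r - 0)).
  apply: sum_natr_le => k; rewrite mem_index_iota => /= kr.
  have X2 : 2 <= 2 * B `^ q%:R^-1 by rewrite ler_peMr// powR_ge1.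
  apply: le_trans (fermat _ e0 _ _ _ al0 be0 nu0 k _ _ _ _ X2 X2 _) _; first lia.
    by rewrite ler_peMr.
  rewrite fermat_bound_box// ler_wpM2r ?powR_ge0// ler_wpM2r ?powR_ge0//.
  by rewrite ler_wpM2r ?powR_ge0// ler_norm.
have := HK5 (B `^ a0); have := HK6 (B `^ b0); have := HK7 (B `^ (1 - r%:R^-1)).
rewrite -!powRrM !powR_gt0// -/S5 -/S6 -/S7 => /(_ isT) H7 /(_ isT) H6 /(_ isT) H5.
pose E3 : R := a0 * (p.+1%:R^-1 + e) + b0 * (q.+1%:R^-1 + e)
  + (1 - r%:R^-1) * (r%:R^-1 + e) + (e + kappa / q%:R).
apply: (@le_trans _ _ (K5 * K6 * K7 * r%:R * M * B `^ E3)); last first.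
  exact: mulr_powR_le.
have MF : 0 <= r%:R * (M * F) by rewrite !mulr_ge0// powR_ge0.
rewrite !(BD _ (e + _)) -/F (BD (_ + _)) (BD (a0 * _)).
set x5 := B `^ (a0 * _) in H5 *; set x6 := B `^ (b0 * _) in H6 *.
set x7 := B `^ (_ * _) in H7 *.
have -> : K5 * K6 * K7 * r%:R * M * (x5 * x6 * x7 * F)
  = K5 * x5 * (K6 * x6 * (K7 * x7 * (r%:R * (M * F)))) by ring.
apply: ler_pM => //; first by rewrite !mulr_ge0// powR_ge0.
apply: ler_pM => //; first by rewrite !mulr_ge0// powR_ge0.
by rewrite ler_wpM2r.
Qed.

Theorem theorem4p1 (R : realType) (p : nat) (kappa : R) (C : R -> R)
    (delta : R) (kappa_ge0 : 0 <= kappa) :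
  exists K : R, forall q r : nat,
    (2 <= r)%N -> (r <= q)%N -> (q <= p)%N ->
    (forall eps : R, 0 < eps ->
     forall lambda mu nu : int, lambda != 0 -> mu != 0 -> nu != 0 ->
     forall k : nat, (k <= r - 1)%N ->
     forall X Y Z : R, 2 <= X -> 2 <= Y -> 2 <= Z ->
       (num_triples (fermat_solutions p q (r + k)%N lambda mu nu X Y Z))%:R
         <= C eps * Num.max (Num.max X Y) Z `^ eps * Num.max X Y `^ kappa) ->
    delta < (p%:R^-1 + q%:R^-1
               - (r%:R^-1 - (q%:R * r%:R)^-1 + kappa / q%:R))
            / (p%:R + q%:R + 1 + r%:R^-1) ->
    forall B : R, 1 <= B ->
      (num_triples (abc_triples p q r B))%:R
        <= K * B `^ (p%:R^-1 + q%:R^-1 - delta).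
Proof.
(* The constant may depend on (q, r), as only finitely many pairs satisfy
   r <= q <= p. *)
pose good (i : 'I_p.+1 * 'I_p.+1) (K : R) := forall B : R, 1 <= B ->
  (num_triples (abc_triples p i.1 i.2 B))%:R
    <= K * B `^ (p%:R^-1 + i.1%:R^-1 - delta).
have goodW i K K' : K <= K' -> good i K -> good i K'.
  move=> KK' gK B B1; apply: (le_trans (gK B B1)).
  by rewrite ler_wpM2r// powR_ge0.
have /choice[K HK] (i : 'I_p.+1 * 'I_p.+1) :
    exists K : R, (exists K' : R, good i K') -> good i K.
  by have [[K gK]|nK] := pselect (exists K', good i K'); [exists K|exists 0].
exists (\sum_i `|K i|) => q r r2 rq qp fermat delta_lt.
have qp1 : (q < p.+1)%N by [].
have rp1 : (r < p.+1)%N by exact: leq_ltn_trans rq qp1.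
pose i : 'I_p.+1 * 'I_p.+1 := (Ordinal qp1, Ordinal rp1).
apply: (goodW i (K i)).
  by rewrite (bigD1 i)//= (le_trans (ler_norm _))// lerDl sumr_ge0.
by apply: HK; apply: abc_count_fixed fermat delta_lt.
Qed.
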